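(* Let $n$ be a positive integer with $n\equiv 3 \pmod 6$, let $G$ be the fundamental group of the complement in $S^3$ of the 2-bridge knot $(4n-1/4n-3)$, and let $K=G'$ be its commutator subgroup. Then there are infinitely many homomorphisms from $K$ to the symmetric group $S_3$, and hence $K$ has subgroups of every finite index.
   Context: For coprime integers $p,q$ with $p$ odd and $0<q<p$, $(p/q)$ denotes the corresponding 2-bridge knot in $S^3$. The convention is as follows: for $1\le i\le p-1$ write $iq=k_ip+r_i$ with $0<r_i<p$ and set $e_i=(-1)^{k_i}$. Then the fundamental group of the complement of the 2-bridge knot $(p/q)$ has the presentation $$\langle u,v\mid uw=wv\rangle,\qquad w=v^{e_1}u^{e_2}\cdots u^{e_{p-2}}v^{e_{p-1}},$$ with $u$ a meridian of the knot. Here $p=4n-1$ and $q=4n-3$. A representation of $K$ into $S_3$ means a group homomorphism $K\to S_3$. *)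

(* Defs.v *)
From HB Require Import structures.
From mathcomp Require Import all_boot.
From mathcomp Require Import boolp classical_sets cardinality.

Set Implicit Arguments.
Unset Strict Implicit.
Unset Printing Implicit Defensive.

Local Open Scope group_scope.
Local Open Scope quotient_scope.

(* A letter (x, false) stands for the generator x and (x, true) for x^-1. *)
Definition word (X : Type) := seq (X * bool).

Inductive word_eq (X : Type) (rels : word X -> word X -> Prop) :
    word X -> word X -> Prop :=
| word_eq_refl s : word_eq rels s s
| word_eq_sym s t : word_eq rels s t -> word_eq rels t s
| word_eq_trans s t r : word_eq rels s t -> word_eq rels t r -> word_eq rels s r
| word_eq_cat s s' t t' : word_eq rels s s' -> word_eq rels t t' ->
    word_eq rels (s ++ t) (s' ++ t')
| word_eq_cancel x b : word_eq rels [:: (x, b); (x, ~~ b)] [::]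
| word_eq_rel s t : rels s t -> word_eq rels s t.

Definition inv_word (X : Type) (s : word X) : word X :=
  rev [seq (l.1, ~~ l.2) | l <- s].

Section Presentation.
Variables (X : choiceType) (rels : word X -> word X -> Prop).

Definition word_eqb : rel (word X) := fun s t => `[< word_eq rels s t >].

Lemma word_eqb_equiv : equiv_class_of word_eqb.
Proof.
split=> [s|s t|t s r].
- by apply/asboolP; apply: word_eq_refl.
- by apply/asboolP/asboolP; apply: word_eq_sym.
- move=> /asboolP st /asboolP tr; apply/asboolP; exact: word_eq_trans tr.
Qed.

Canonical word_eqb_equiv_rel := EquivRelPack word_eqb_equiv.

(* The group < X | s = t for rels s t >. *)
Definition presented := {eq_quot word_eqb}.
HB.instance Definition _ := Choice.on presented.
HB.instance Definition _ := Quotient.on presented.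

Lemma pi_presentedP (s t : word X) :
  \pi_presented s = \pi_presented t <-> word_eq rels s t.
Proof.
split=> [/eqquotP /asboolP //|st]; by apply/eqquotP/asboolP.
Qed.

Let repr_pi (s : word X) : word_eq rels (repr (\pi_presented s)) s.
Proof. by apply/pi_presentedP; rewrite reprK. Qed.

Definition presented_mul (a b : presented) : presented :=
  \pi_presented (repr a ++ repr b).
Definition presented_inv (a : presented) : presented :=
  \pi_presented (inv_word (repr a)).
Definition presented_one : presented := \pi_presented [::].

Lemma presented_mulA : associative presented_mul.
Proof.
move=> a b c; apply/pi_presentedP.
apply: (@word_eq_trans _ _ _ (repr a ++ (repr b ++ repr c))).
  by apply: word_eq_cat; [exact: word_eq_refl | exact: repr_pi].
rewrite catA; apply: word_eq_cat; last exact: word_eq_refl.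
by apply: word_eq_sym; exact: repr_pi.
Qed.

Lemma presented_mul1g : left_id presented_one presented_mul.
Proof.
move=> a; rewrite -[RHS]reprK; apply/pi_presentedP.
rewrite -[X in word_eq _ _ X]cat0s.
by apply: word_eq_cat; [exact: repr_pi | exact: word_eq_refl].
Qed.

Lemma presented_mulg1 : right_id presented_one presented_mul.
Proof.
move=> a; rewrite -[RHS]reprK; apply/pi_presentedP.
rewrite -[X in word_eq _ _ X]cats0.
by apply: word_eq_cat; [exact: word_eq_refl | exact: repr_pi].
Qed.

Lemma word_eq_invl (s : word X) : word_eq rels (inv_word s ++ s) [::].
Proof.
elim: s => [|[x b] s IHs]; first exact: word_eq_refl.
have -> : inv_word ((x, b) :: s) ++ (x, b) :: s =
    inv_word s ++ ([:: (x, ~~ b); (x, b)] ++ s).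
  by rewrite /inv_word /= rev_cons cat_rcons.
apply: word_eq_trans IHs; apply: word_eq_cat; first exact: word_eq_refl.
rewrite -[X in word_eq _ _ X]cat0s.
apply: word_eq_cat; last exact: word_eq_refl.
by have := word_eq_cancel rels x (~~ b); rewrite negbK.
Qed.

Lemma inv_wordK : involutive (@inv_word X).
Proof.
move=> s; rewrite /inv_word map_rev revK -map_comp map_id_in //.
by move=> [x b] _ /=; rewrite negbK.
Qed.

Lemma presented_mulVg : left_inverse presented_one presented_inv presented_mul.
Proof.
move=> a; apply/pi_presentedP; apply: word_eq_trans (word_eq_invl (repr a)).
by apply: word_eq_cat; [exact: repr_pi | exact: word_eq_refl].
Qed.

Lemma presented_mulgV : right_inverse presented_one presented_inv presented_mul.
Proof.
move=> a; apply/pi_presentedP.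
apply: word_eq_trans (word_eq_invl (inv_word (repr a))); rewrite inv_wordK.
by apply: word_eq_cat; [exact: word_eq_refl | exact: repr_pi].
Qed.

HB.instance Definition _ := isGroup.Build presented presented_mulA
  presented_mul1g presented_mulg1 presented_mulVg presented_mulgV.

End Presentation.

Section Subgroups.
Variable G : groupType.

Definition generated_subgroup (A : {pred G}) : {pred G} :=
  fun z => `[< forall H : {pred G},
    group_closed H -> {subset A <= H} -> z \in H >].

Definition is_commutator : {pred G} :=
  fun z => `[< exists x y : G, z = [~ x, y] >].

Definition commutator_subgroup : {pred G} := generated_subgroup is_commutator.

Lemma commutator_subgroup_closed : group_closed commutator_subgroup.
Proof.
split=> [|x y /asboolP xG /asboolP yG]; apply/asboolP => H HG AH.
  by case: HG.
by case: (HG) => _; apply; [exact: xG | exact: yG].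
Qed.

Definition derived := {x : G | x \in commutator_subgroup}.
HB.instance Definition _ := [isSub of derived for @proj1_sig _ _].
HB.instance Definition _ := [Choice of derived by <:].
HB.instance Definition _ :=
  SubChoice_isSubGroup.Build G _ derived commutator_subgroup_closed.

Definition left_coset (H : {pred G}) (x : G) : set G :=
  [set x * h | h in [set` H]]%classic.

Definition has_index (H : {pred G}) (m : nat) : Prop :=
  (range (left_coset H) #= `I_m)%card.

End Subgroups.

Definition gen_u : bool := false.
Definition gen_v : bool := true.

(* w = v^{e_1} u^{e_2} v^{e_3} ... v^{e_{p-2}} u^{e_{p-1}}: the generators
   alternate, and since p - 1 is even the last one is u. Here e_i = (-1)^{k_i}
   with k_i the quotient of i * q by p, so that the i-th letter is inverted
   exactly when k_i is odd. *)
Definition two_bridge_word (p q : nat) : word bool :=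
  [seq (if odd i then gen_v else gen_u, odd ((i * q) %/ p)) | i <- iota 1 p.-1].

Definition two_bridge_rel (p q : nat) (s t : word bool) : Prop :=
  s = (gen_u, false) :: two_bridge_word p q /\
  t = rcons (two_bridge_word p q) (gen_v, false).

(* The group < u, v | u w = w v >. It is the fundamental group of the complement
   of the 2-bridge knot (p/q) for coprime odd 0 < q < p. *)
Definition two_bridge_group (p q : nat) : groupType :=
  presented (two_bridge_rel p q).

(* Main.v *)
(* Put x = v u^-1 and x_i = u^i x u^-i. The word of the relation is
   w = (v u^-1)^(n-1) v u (v^-1 u)^(n-1), and K is generated by the x_i, subject
   to x_i^n x_(i+1)^(1-n) x_(i+2) = x_(i+1)^n x_(i+2)^(1-n). If the t_k are
   involutions of a group T with (t_k t_(k+1))^3 = 1, and n = 3 mod 6, then the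
   sequence ..., t_k, t_k, t_k t_(k+1), t_(k+1), t_(k+1), ... satisfies these
   relations, so it defines a homomorphism K -> T. Arbitrary sequences of
   transpositions in S_3 are allowed, whence infinitely many homomorphisms; the
   Coxeter generators of S_m give a transitive action of K on m points, whose
   stabilizers have index m.

   To avoid presenting K, a sequence (x_i) is viewed as a T-valued holonomy on
   the infinite cyclic cover of the presentation complex: a word read from level
   i contributes 1 for each u, x_j for each v climbing from level j to j + 1,
   and x_j^-1 for each v^-1 descending from level j + 1 to j. Elements of K
   return to their starting level, so that the holonomy is multiplicative on K. *)

Require Import Defs.
From mathcomp Require Import all_boot all_order all_fingroup.
From mathcomp Require Import boolp classical_sets cardinality.
From mathcomp Require Import ssralg ssrint intdiv zify generic_quotient.
From HB Require Import structures.

Set Implicit Arguments.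
Unset Strict Implicit.
Unset Printing Implicit Defensive.

Local Open Scope group_scope.

Lemma mul_pi_presented (X : choiceType) (rels : word X -> word X -> Prop)
    (s t : word X) :
  (\pi_(presented rels) s * \pi_(presented rels) t =
   \pi_(presented rels) (s ++ t))%qT.
Proof.
by apply/pi_presentedP/word_eq_cat; apply/pi_presentedP; rewrite reprK.
Qed.

(** * Shift and holonomy of words *)

Section Holonomy.
Variables (T : groupType) (x : int -> T).

Definition letter_shift (l : bool * bool) : int := (if l.2 then -1 else 1)%R.

Definition letter_holonomy (l : bool * bool) (i : int) : T :=
  if l.1 == gen_u then 1 else if l.2 then (x (i - 1)%R)^-1 else x i.

Fixpoint word_shift (s : word bool) : int :=
  if s is l :: s' then (letter_shift l + word_shift s')%R else 0%R.

Fixpoint holonomy (s : word bool) (i : int) : T :=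
  if s is l :: s' then letter_holonomy l i * holonomy s' (i + letter_shift l)%R
  else 1.

Lemma word_shift_cat s t :
  word_shift (s ++ t) = (word_shift s + word_shift t)%R.
Proof. by elim: s => [|l s IHs] /=; lia. Qed.

Lemma holonomy_cat s t i :
  holonomy (s ++ t) i = holonomy s i * holonomy t (i + word_shift s)%R.
Proof.
elim: s i => [|l s IHs] i /=; first by rewrite mul1g GRing.addr0.
by rewrite IHs mulgA GRing.addrA.
Qed.

(** Shift and holonomy go through the induction together, because in a concatenation the shift of
    the first word fixes the level at which the second is read. *)
Lemma word_eq_holonomy (rels : word bool -> word bool -> Prop) s t :
  (forall s t, rels s t ->
    word_shift s = word_shift t /\ holonomy s =1 holonomy t) ->
  word_eq rels s t -> word_shift s = word_shift t /\ holonomy s =1 holonomy t.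
Proof.
move=> relsP; elim=> {s t} [//|s t _ [-> st]|s t r _ [-> st] _ [-> tr]|
  s s' t t' _ [ds es] _ [dt et]|g b|s t /relsP//].
- by split=> // i; rewrite st.
- by split=> // i; rewrite st.
- by split=> [|i]; rewrite ?word_shift_cat ?holonomy_cat ?ds ?dt ?es ?et.
split=> [|i]; first by case: b.
case: g b => -[]; rewrite /= /letter_holonomy /letter_shift /= ?mul1g // mulg1.
  exact: mulVg.
by rewrite GRing.addrK mulgV.
Qed.

End Holonomy.

(** * The word w of the knot; from here on [n.+1] is the knot parameter *)

Lemma map_iota_flatten (A : eqType) (f : nat -> A) (c d : A) (a k : nat) :
  (forall j, j < k -> f (a + j.*2) = c /\ f (a + j.*2).+1 = d) ->
  [seq f i | i <- iota a k.*2] = flatten (nseq k [:: c; d]).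
Proof.
elim: k a => [//|k IHk] a fP /=.
have [] := fP 0%N isT; rewrite addn0 => -> ->; congr [:: _, _ & _].
by rewrite -(IHk a.+2) // => j jk; rewrite !addSnnS -doubleS; exact: fP.
Qed.

Lemma two_bridge_wordE n :
  two_bridge_word (4 * n.+1 - 1) (4 * n.+1 - 3) =
  flatten (nseq n [:: (gen_v, false); (gen_u, true)]) ++
  [:: (gen_v, false); (gen_u, false)] ++
  flatten (nseq n [:: (gen_v, true); (gen_u, false)]).
Proof.
rewrite /two_bridge_word (_ : (4 * _ - 1).-1 = n.*2 + (2 + n.*2))%N; last lia.
rewrite !iotaD !map_cat.
set f := (X in map X).
(* As q = p - 2, i q = i p - 2 i, so the quotient is i - 1 while 2 i < p, that is up to i = 2 n + 1,
   and i - 2 afterwards. *)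
have lo i : 0 < i <= n.*2.+1 -> f i = (odd i, ~~ odd i).
  move=> hi; rewrite /f (_ : _ %/ _ = i.-1); last by nia.
  by congr pair; [case: odd | lia].
have hi i : n.*2.+1 < i <= n.*2.+1.*2 -> f i = (odd i, odd i).
  move=> hi; rewrite /f (_ : _ %/ _ = i.-2); last by nia.
  by congr pair; [case: odd | lia].
rewrite /gen_v /gen_u; congr (_ ++ (_ ++ _)).
- apply: (map_iota_flatten (f := f)) => j jn.
  by rewrite !lo; try lia; split; congr pair; lia.
- rewrite /= lo ?hi; try lia.
  by congr [:: (_, _); (_, _)]; lia.
apply: (map_iota_flatten (f := f)) => j jn.
by rewrite !hi; try lia; split; congr pair; lia.
Qed.

(** * Holonomy on the knot group and on its commutator subgroup *)

Section KnotHolonomy.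
Variables (n : nat) (T : groupType) (x : int -> T).
Hypothesis x_rel : forall i : int,
  x (i + 1)%R ^+ n.+1 * x (i + 2)%R ^- n =
  x i ^+ n.+1 * x (i + 1)%R ^- n * x (i + 2)%R.

Let rels := two_bridge_rel (4 * n.+1 - 1) (4 * n.+1 - 3).
Let G := two_bridge_group (4 * n.+1 - 1) (4 * n.+1 - 3).

Lemma holonomy_vu_iter k i :
  holonomy x (flatten (nseq k [:: (gen_v, false); (gen_u, true)])) i = x i ^+ k.
Proof.
elim: k => [|k IHk]; first by rewrite expg0.
rewrite /= /letter_holonomy /letter_shift /= mul1g GRing.addrK.
by rewrite IHk expgS.
Qed.

Lemma holonomy_Vu_iter k i :
  holonomy x (flatten (nseq k [:: (gen_v, true); (gen_u, false)])) i =
  x (i - 1)%R ^- k.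
Proof.
elim: k => [|k IHk]; first by rewrite expg0 invg1.
rewrite /= /letter_holonomy /letter_shift /= mul1g GRing.subrK.
by rewrite IHk expgSr invgM.
Qed.

Lemma word_shift_iter k (g h b : bool) :
  word_shift (flatten (nseq k [:: (g, b); (h, ~~ b)])) = 0%R.
Proof. by elim: k => //= k ->; rewrite /letter_shift /=; case: b. Qed.

(** Reading u w and w v from level i yields the two sides of [x_rel]. *)
Lemma holonomy_rel s t :
  rels s t -> word_shift s = word_shift t /\ holonomy x s =1 holonomy x t.
Proof.
case=> -> ->; rewrite -cats1 two_bridge_wordE.
have sVu := word_shift_iter n gen_v gen_u true.
have svu := word_shift_iter n gen_v gen_u false.
split=> [|i]; first by rewrite -cat1s !word_shift_cat sVu svu.
rewrite -cat1s !holonomy_cat !holonomy_vu_iter !holonomy_Vu_iter.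
rewrite !word_shift_cat sVu svu /= /letter_holonomy /letter_shift /=.
rewrite !(mul1g, mulg1) !(GRing.addr0, GRing.add0r).
have e1 : (i + 1 + (1 + 1) - 1 = i + 2)%R by lia.
have e2 : (i + (1 + 1) - 1 = i + 1)%R by lia.
by rewrite e1 e2 !mulgA -!expgSr x_rel.
Qed.

Definition pi_shift (g : G) : int := word_shift (repr g).
Definition pi_holonomy (g : G) : int -> T := holonomy x (repr g).

(** Both maps are defined through a chosen representative; [holonomy_rel] makes them independent of
    the choice. *)
Lemma pi_holonomyE s :
  pi_shift (\pi_(presented rels) s)%qT = word_shift s /\
  pi_holonomy (\pi_(presented rels) s)%qT =1 holonomy x s.
Proof.
by apply: (word_eq_holonomy holonomy_rel); apply/pi_presentedP; rewrite reprK.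
Qed.

Lemma pi_shift1 : pi_shift 1 = 0%R.
Proof. by have [->] := pi_holonomyE [::]. Qed.

Lemma pi_shiftM a b : pi_shift (a * b) = (pi_shift a + pi_shift b)%R.
Proof.
by have [->] := pi_holonomyE (repr a ++ repr b); rewrite word_shift_cat.
Qed.

Lemma pi_shiftV a : pi_shift a^-1 = (- pi_shift a)%R.
Proof. by have := pi_shiftM a a^-1; rewrite mulgV pi_shift1; lia. Qed.

Lemma pi_holonomy1 i : pi_holonomy 1 i = 1.
Proof. by have [_ ->] := pi_holonomyE [::]. Qed.

Lemma pi_holonomyM a b i :
  pi_holonomy (a * b) i = pi_holonomy a i * pi_holonomy b (i + pi_shift a)%R.
Proof.
by have [_ ->] := pi_holonomyE (repr a ++ repr b); rewrite holonomy_cat.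
Qed.

(** The shift is a homomorphism to the integers, so its kernel is a subgroup containing every
    commutator. *)
Lemma pi_shift_derived (g : derived G) : pi_shift (val g) = 0%R.
Proof.
have /asboolP/(_ [pred h | pi_shift h == 0%R]) := valP g.
move=> gP; apply/eqP; apply: gP => [|h /asboolP[a [b ->]]].
  split=> [|a b /eqP a0 /eqP b0]; first by rewrite inE pi_shift1 eqxx.
  by rewrite inE pi_shiftM pi_shiftV a0 b0.
by rewrite inE commgEl !pi_shiftM !pi_shiftV; lia.
Qed.

Definition derived_holonomy (g : derived G) : T := pi_holonomy (val g) 0%R.

Lemma derived_holonomyM : {morph derived_holonomy : a b / a * b}.
Proof.
by move=> a b; rewrite /derived_holonomy valM pi_holonomyM pi_shift_derived.
Qed.

Lemma pi_holonomyV a i :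
  pi_holonomy a^-1 i = (pi_holonomy a (i - pi_shift a)%R)^-1.
Proof.
apply: (mulgI (pi_holonomy a (i - pi_shift a)%R)).
rewrite mulgV -[LHS](_ : pi_holonomy (a * a^-1) (i - pi_shift a)%R = _).
  by rewrite mulgV pi_holonomy1.
by rewrite pi_holonomyM GRing.subrK.
Qed.

End KnotHolonomy.

(** * The elements x_k = u^k v u^-1 u^-k of K *)

Section Generators.
Variable n : nat.
Let p := 4 * n.+1 - 1.
Let q := 4 * n.+1 - 3.
Let G := two_bridge_group p q.
Let class (s : word bool) : G := (\pi_(presented (two_bridge_rel p q)) s)%qT.
Let u := class [:: (gen_u, false)].
Let v := class [:: (gen_v, false)].

Definition meridian_quotient (k : nat) : G := (v * u^-1) ^ (u ^- k).

(** The relation gives v = w^-1 u w, hence v u^-1 = [[~ w, u^-1]], and a conjugate of a commutator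
    is a commutator. *)
Lemma meridian_quotient_commutator k :
  meridian_quotient k \in commutator_subgroup (G := G).
Proof.
apply/asboolP => H _; apply; apply/asboolP.
pose w := class (two_bridge_word p q).
have uw : u * w = w * v.
  rewrite /u /w /v /class !mul_pi_presented; apply/pi_presentedP/word_eq_rel.
  by split; rewrite // cats1.
exists (w ^ (u ^- k)), (u^-1 ^ (u ^- k)); rewrite -conjRg; congr (_ ^ _).
by rewrite commgEl conjgE invgK !mulgA -[w^-1 * u * w]mulgA uw mulKg.
Qed.

Definition derived_generator (k : nat) : derived G :=
  Sub (meridian_quotient k) (meridian_quotient_commutator k).

(** Along u^k v u^-1 u^-k only the letter v contributes, and it is read at level k. *)
Lemma derived_generator_holonomy (T : groupType) (x : int -> T)
    (x_rel : forall i : int, x (i + 1)%R ^+ n.+1 * x (i + 2)%R ^- n =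
      x i ^+ n.+1 * x (i + 1)%R ^- n * x (i + 2)%R) k :
  derived_holonomy x (derived_generator k) = x k.
Proof.
rewrite /derived_holonomy /= /meridian_quotient conjgE invgK.
have [u_shift u_hol] := pi_holonomyE x_rel [:: (gen_u, false)].
have [v_shift v_hol] := pi_holonomyE x_rel [:: (gen_v, false)].
rewrite -/(class _) -/u in u_shift u_hol.
rewrite -/(class _) -/v in v_shift v_hol.
have [uk_shift uk_hol] :
    pi_shift (u ^+ k) = k /\ pi_holonomy x (u ^+ k) =1 fun=> 1.
  elim: k => [|k [IHs IHh]].
    by split=> [|i]; [rewrite (pi_shift1 x_rel) | rewrite (pi_holonomy1 x_rel)].
  rewrite expgS (pi_shiftM x_rel); split=> [|i].
    by rewrite IHs u_shift /= /letter_shift /=; lia.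
  by rewrite (pi_holonomyM x_rel) IHh u_hol /= /letter_holonomy /= !mulg1.
rewrite !(pi_holonomyM x_rel) !(pi_holonomyV x_rel) !uk_hol u_hol v_hol.
by rewrite /= /letter_holonomy /= !(mulg1, mul1g, invg1) uk_shift GRing.add0r.
Qed.

End Generators.

(** * Solutions of the relations built from involutions *)

Section PeriodicSequence.
Variables (T : groupType) (t : nat -> T).
Hypothesis t_involution : forall k, t k ^+ 2 = 1.
Hypothesis t_braid : forall k, (t k * t k.+1) ^+ 3 = 1.

(* The sequence t is extended to negative indices by t_(-k) = t_k. *)
Let c (k : int) := t (absz k) * t (absz (k + 1)%R).

Definition braid_sequence (i : int) : T :=
  let k := (i %/ 3)%Z in if (i %% 3)%Z == 2 then c k else t (absz k).

Lemma braid_sequence0 k : braid_sequence (3%:Z * k)%R = t (absz k).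
Proof. rewrite /braid_sequence (_ : (_ %/ _)%Z = k) ?ifN //; lia. Qed.

Lemma braid_sequence1 k : braid_sequence (3%:Z * k + 1)%R = t (absz k).
Proof. rewrite /braid_sequence (_ : (_ %/ _)%Z = k) ?ifN //; lia. Qed.

Lemma braid_sequence2 k : braid_sequence (3%:Z * k + 2)%R = c k.
Proof. rewrite /braid_sequence (_ : (_ %/ _)%Z = k) ?ifT //; lia. Qed.

(** Since [n.+1] is odd and divisible by 3, t^n = 1 for an involution t, and c^(n+1) = 1, c^-n = c
    when c^3 = 1. For i = 0, 1, 2 mod 3 both sides reduce to t_k c_k, to 1 (as t_k c_k t_(k+1) = 1),
    and to t_(k+1). *)
Lemma braid_sequence_rel (n : nat) (i : int) : n.+1 = 3 %[mod 6] ->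
  let x := braid_sequence in
  x (i + 1)%R ^+ n.+1 * x (i + 2)%R ^- n =
  x i ^+ n.+1 * x (i + 1)%R ^- n * x (i + 2)%R.
Proof.
move=> n_mod x.
have [m n_eq] : exists m, n = (6 * m + 2)%N by exists (n.+1 %/ 6); lia.
have t_n k : t k ^+ n = 1.
  have -> : n = (2 * (3 * m).+1)%N by lia.
  by rewrite expgM t_involution expg1n.
have tV k : (t k)^-1 = t k.
  by apply: (mulgI (t k)); rewrite mulgV -expg2 t_involution.
have t_n1 k : t k ^+ n.+1 = t k by rewrite expgS t_n mulg1.
have c3 k : c k ^+ 3 = 1.
  rewrite /c; case: k => [k|k].
    by rewrite (_ : absz (_ + 1)%R = k.+1); [exact: t_braid | lia].
  (* At a negative index the reflected product is t_(k+1) t_k, the inverse of t_k t_(k+1). *)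
  have -> : absz (Negz k) = k.+1 by lia.
  have -> : absz (Negz k + 1)%R = k by lia.
  by apply: invg_inj; rewrite -expVgn invgM invg1 !tV t_braid.
have c_n1 k : c k ^+ n.+1 = 1.
  have -> : n.+1 = (3 * (2 * m).+1)%N by lia.
  by rewrite expgM c3 expg1n.
have c_n k : c k ^- n = c k.
  by apply: (mulgI (c k ^+ n)); rewrite mulgV -expgSr c_n1.
have [k] : exists k : int,
    i = (3%:Z * k)%R \/ i = (3%:Z * k + 1)%R \/ i = (3%:Z * k + 2)%R.
  by exists (i %/ 3)%Z; lia.
rewrite /x => -[->|[->|->]].
- rewrite braid_sequence0 braid_sequence1 braid_sequence2.
  by rewrite t_n1 t_n c_n invg1 mulg1.
- have -> : (3%:Z * k + 1 + 1 = 3%:Z * k + 2)%R by lia.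
  have -> : (3%:Z * k + 1 + 2 = 3%:Z * (k + 1))%R by lia.
  rewrite braid_sequence0 braid_sequence1 braid_sequence2.
  rewrite t_n t_n1 c_n1 c_n /c invg1 mulg1 mulgA -expg2 t_involution mul1g.
  by rewrite -expg2 t_involution.
- have -> : (3%:Z * k + 2 + 1 = 3%:Z * (k + 1))%R by lia.
  have -> : (3%:Z * k + 2 + 2 = 3%:Z * (k + 1) + 1)%R by lia.
  rewrite braid_sequence0 braid_sequence1 braid_sequence2.
  by rewrite t_n t_n1 c_n1 !(invg1, mulg1, mul1g).
Qed.

End PeriodicSequence.

(** * Transpositions and stabilizers *)

Lemma tperm_braid (A : finType) (a b c : A) :
  a != b -> b != c -> a != c -> (tperm a b * tperm b c) ^+ 3 = 1.
Proof.
move=> ab bc ac.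
have ca : c != a by rewrite eq_sym.
have ba : b != a by rewrite eq_sym.
have aba : tperm a b * (tperm b c * tperm a b) = tperm a c.
  by rewrite -{1}(tpermV a b) -conjgE tpermJ tpermR tpermD.
have bab : tperm b c * (tperm a b * tperm b c) = tperm a c.
  by rewrite -{1}(tpermV b c) -conjgE tpermJ tpermL tpermD.
(* The product of six factors splits into the two braid words, both equal to [tperm a c]. *)
rewrite !expgS expg0 mulg1 -!mulgA bab.
by rewrite [tperm b c * _]mulgA mulgA aba tperm2.
Qed.

Lemma multiplicative1 (G H : groupType) (f : {multiplicative G -> H}) : f 1 = 1.
Proof. by apply: (mulgI (f 1)); rewrite -gmulfM !mulg1. Qed.

(** Orbit-stabilizer, with [H] the stabilizer of [i0]. *)
Lemma stabilizer_index (K : groupType) (m : nat)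
    (f : {multiplicative K -> 'S_m}) (i0 : 'I_m) :
  (forall j, exists g, f g i0 = j) ->
  exists H : {pred K}, group_closed H /\ has_index H m.
Proof.
move=> /boolp.choice[g gP].
have f1 : f 1 = 1 by exact: multiplicative1.
have fV a : f a^-1 = (f a)^-1.
  by apply: (mulgI (f a)); rewrite -gmulfM !mulgV f1.
pose H : {pred K} := [pred h | f h i0 == i0]; exists H; split.
  have HE a : (a \in H) = (f a i0 == i0) by [].
  split=> [|a b /eqP fa /eqP fb]; first by rewrite HE f1 perm1.
  by rewrite HE gmulfM fV permM fa -[in X in X == _]fb permK.
(* Permutations compose from left to right, so the left coset of a is determined by the point
   [f a^-1 i0]; this is why the representatives below are the [(g j)^-1]. *)
have cosetP a y : left_coset H a y <-> f y (f a^-1 i0) = i0.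
  split=> [[h /eqP fh <-]|fy].
    by rewrite gmulfM -permM mulgA -gmulfM mulVg f1 mul1g.
  by exists (a^-1 * y); [apply/eqP; rewrite gmulfM permM | rewrite mulVKg].
have coset_inj a b : left_coset H a = left_coset H b -> f a^-1 i0 = f b^-1 i0.
  move=> ab; apply: (@perm_inj _ (f a)); have /cosetP -> : left_coset H b a.
    by rewrite -ab; apply/cosetP; rewrite -permM -gmulfM mulVg f1 perm1.
  by rewrite -permM -gmulfM mulVg f1 perm1.
rewrite /has_index card_eq_sym; apply: (card_eq_trans card_II).
rewrite (_ : range _ = [set left_coset H (g j)^-1 | j in [set: 'I_m]])%classic.
  rewrite card_eq_sym; apply: inj_card_eq => i j _ _ /coset_inj.
  by rewrite !invgK !gP.
apply/seteqP; split=> [_ [a _ <-]|_ [j _ <-]]; last by exists (g j)^-1.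
exists (f a^-1 i0) => //; apply/predeqP => y.
by split=> /cosetP e; apply/cosetP; move: e; rewrite invgK gP.
Qed.

(** * Homomorphisms from K to symmetric groups *)

Section SymmetricQuotients.
Variable n : nat.
Hypothesis n_mod : n.+1 = 3 %[mod 6].
Let K := derived (two_bridge_group (4 * n.+1 - 1) (4 * n.+1 - 3)).

(** The index 3 k is a place where [braid_sequence] takes the value t_k, so f determines t. *)
Lemma derived_morphism (T : groupType) (t : nat -> T) :
  (forall k, t k ^+ 2 = 1) -> (forall k, (t k * t k.+1) ^+ 3 = 1) ->
  exists f : {multiplicative K -> T},
    forall k, f (derived_generator n (3 * k)) = t k.
Proof.
move=> t_inv t_br.
have x_rel := fun i => braid_sequence_rel t_inv t_br i n_mod.
pose f : {multiplicative K -> T} := HB.pack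
  (derived_holonomy (braid_sequence t) : K -> T)
  (isMultiplicative.Build K T _ (derived_holonomyM x_rel)).
exists f => k; rewrite /f /= (derived_generator_holonomy x_rel).
by rewrite PoszM braid_sequence0.
Qed.

Lemma infinite_S3 : infinite_set [set: {multiplicative K -> 'S_3}]%classic.
Proof.
pose a : 'S_3 := tperm ord0 (inord 1).
pose b : 'S_3 := tperm (inord 1) (inord 2).
have ab : (a * b) ^+ 3 = 1 by apply: tperm_braid; rewrite -val_eqE /= !inordK.
have ba : (b * a) ^+ 3 = 1.
  by rewrite /a /b !(tpermC _ (inord 1)) tpermC; apply: tperm_braid;
    rewrite -val_eqE /= !inordK.
have a2 : a ^+ 2 = 1 by rewrite expg2 tperm2.
have b2 : b ^+ 2 = 1 by rewrite expg2 tperm2.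
have anb : a != b.
  apply/eqP => /permP/(_ ord0); rewrite tpermL tpermD -?val_eqE /= ?inordK //.
  by move/(congr1 val); rewrite /= inordK.
(* The k-th sequence is a except for a single b at position k. *)
pose t (k j : nat) := if j == k then b else a.
have [F FP] : exists F : nat -> {multiplicative K -> 'S_3},
    forall k j, F k (derived_generator n (3 * j)) = t k j.
  suff /boolp.choice [F FP] : forall k, exists f : {multiplicative K -> 'S_3},
      forall j, f (derived_generator n (3 * j)) = t k j by exists F.
  move=> k.
  apply: derived_morphism => j; rewrite /t; first by case: eqP.
  case: (j =P k) => [->|_].
    by rewrite (gtn_eqF (ltnSn k)).
  by case: eqP => // _; rewrite -expg2 a2 expg1n.
move=> fin; apply: infinite_nat.
(* F is injective: on the generator of index 3 k, [F k] gives b, while [F l] gives a unless l =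
   k. *)
rewrite -(preimage_setT F); apply: finite_preimage fin => k l _ _ Fkl.
have := FP k k; rewrite Fkl FP /t eqxx; case: eqP => // _ /eqP.
by rewrite (negPf anb).
Qed.

Lemma derived_subgroup_index m :
  exists H : {pred K}, group_closed H /\ has_index H m.+1.
Proof.
(* Adjacent transpositions, the last one repeated forever. For m = 0 both points are [ord0], [inord]
   defaulting to it, and t is trivial. *)
pose t k : 'S_m.+1 := tperm (inord (minn k m.-1)) (inord (minn k m.-1).+1).
have [f fP] : exists f : {multiplicative K -> 'S_m.+1},
    forall k, f (derived_generator n (3 * k)) = t k.
  apply: derived_morphism => k; first by rewrite expg2 tperm2.
  have [km|mk] := leqP m.-1 k.
    rewrite /t (minn_idPr km) (minn_idPr (leqW km)) tperm2; exact: expg1n.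
  rewrite /t (minn_idPl (ltnW mk)) (minn_idPl mk).
  by apply: tperm_braid; rewrite -val_eqE /= !inordK; lia.
apply: (stabilizer_index (f := f) (i0 := ord0)) => -[j j_lt].
(* Transitivity: [t j] carries the point j to j + 1. *)
elim: j j_lt => [|j IHj] j_lt.
  by exists 1; rewrite multiplicative1 perm1; apply: val_inj.
have [g gj] := IHj (ltnW j_lt).
exists (g * derived_generator n (3 * j)).
rewrite gmulfM permM gj fP /t (minn_idPl _); last by lia.
rewrite (_ : Ordinal _ = inord j) ?tpermL; apply: val_inj; rewrite /= inordK //.
exact: ltnW.
Qed.

End SymmetricQuotients.

Local Close Scope group_scope.

Theorem theorem2p6 (n : nat) :
  0 < n -> n = 3 %[mod 6] ->
  let G : groupType := two_bridge_group (4 * n - 1) (4 * n - 3) in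
  let K : groupType := derived G in
  infinite_set [set: {multiplicative K -> 'S_3}]%classic /\
  (forall m : nat, 0 < m ->
    exists H : {pred K}, group_closed H /\ has_index H m).
Proof.
case: n => // n _ n_mod; split; first exact: infinite_S3.
by case=> // m _; exact: derived_subgroup_index.
Qed.
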